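(* For every $d\in\{5,6,7\}$ and every even integer $\ell>2$, except when $\ell=4$ and $d\in\{6,7\}$, there is a cracked graceful permutation of length $2\ell-1$ with crack $\ell-2$ whose first element is $\ell+1$, whose last element is $\ell$, and whose first absolute difference is $d$.
   Context: A cracked graceful permutation of length $n$ is an arrangement $(a_1,\dots,a_n)$ of $n$ distinct integers from $\{0,1,\dots,n\}$ such that its absolute differences $|a_{i+1}-a_i|$ ($1\le i\le n-1$) are exactly the integers $\{1,\dots,n-1\}$; the missing element of $\{0,\dots,n\}$ is the crack. The first absolute difference is $|a_2-a_1|$. *)

(* Defs.v *)
From mathcomp Require Import all_boot.
Set Implicit Arguments. Unset Strict Implicit. Unset Printing Implicit Defensive.

Definition absdiff (a b : nat) : nat := (a - b) + (b - a).

Definition abs_diffs (s : seq nat) : seq nat :=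
  match s with
  | [::] => [::]
  | x :: t => pairmap (fun a b => absdiff b a) x t
  end.

Definition cracked_graceful (n : nat) (s : seq nat) : bool :=
  [&& size s == n, uniq s, all (fun a => a <= n) s &
      perm_eq (abs_diffs s) (iota 1 n.-1)].

Definition is_crack (n : nat) (s : seq nat) (c : nat) : bool :=
  (c <= n) && (c \notin s).

(* Main.v *)
(* Work with paths on {0, ..., 2h+1} minus one point whose last vertex is h, whose first vertex
   is h+1 or h-1 and whose missing point is h-2 or h+2 respectively; the reflection z -> 2h+1-z
   of a path of the second kind with l = h+1 is what the theorem asks for.  For h odd the
   differences are to be 1, ..., 2h and the path is to contain the edge {0, 2h}; for h even the
   differences are 1, ..., 2h-1 and 2h+1, which forces the edge {0, 2h+1}, and we also ask for
   the edge {0, 2h-1}.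
   Reflecting such a path and replacing one of these extremal edges by a path through h - h' - 1
   new points below and h - h' + 1 new points above yields a path of the other kind for some
   h close to 5h'.  The new path consists of two zigzags, which realize long runs of consecutive
   differences, and a few extra vertices.  Ten such surgeries cover every residue of h modulo 10,
   and they leave the first difference alone, so induction on h reduces everything to finitely
   many explicit paths.

   Vertices and differences are controlled by surjectivity alone: a list of the right length
   meeting every required value has no repetition and no other value. *)
Require Import Defs.
From mathcomp Require Import all_boot zify.
Set Implicit Arguments. Unset Strict Implicit. Unset Printing Implicit Defensive.

(** * Differences under concatenation, reversal and reflection *)

Lemma absdiffC a b : absdiff a b = absdiff b a.
Proof. by rewrite /absdiff addnC. Qed.

Lemma absdiff_subl c a b : a <= c -> b <= c -> absdiff (c - a) (c - b) = absdiff a b.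
Proof. by rewrite /absdiff; lia. Qed.

Lemma abs_diffs_cat A x B :
  abs_diffs (A ++ x :: B) = abs_diffs (rcons A x) ++ abs_diffs (x :: B).
Proof.
case: A => [|a A] //=; rewrite -cats1 !pairmap_cat -catA /=.
by [].
Qed.

Lemma abs_diffs_rev s : abs_diffs (rev s) = rev (abs_diffs s).
Proof.
elim: s => [|x [|y s] IHs] //.
rewrite rev_cons -cats1 rev_cons cat_rcons abs_diffs_cat -rev_cons IHs /=.
by rewrite rev_cons -cats1 absdiffC.
Qed.

Lemma abs_diffs_subl c s :
  all (fun a => a <= c) s -> abs_diffs [seq c - a | a <- s] = abs_diffs s.
Proof.
case: s => //= x s /andP[lexc]; elim: s x lexc => //= y s IHs x lexc /andP[leyc les].
by rewrite absdiff_subl // IHs.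
Qed.

Lemma size_abs_diffs s : size (abs_diffs s) = (size s).-1.
Proof. by case: s => //= x s; rewrite size_pairmap. Qed.

(** * Punctured paths *)

(** Here [w] is the omitted vertex and [g] the omitted difference. A list of [S] entries has [S - 1]
    differences, so for [w] and [g] in range coverage leaves no room for repetition. *)
Definition punctured_path (S u v w g d : nat) (s : seq nat) : bool :=
  [&& size s == S, all (mem s) [seq z <- iota 0 S.+1 | z != w],
      all (mem (abs_diffs s)) [seq e <- iota 1 S | e != g],
      head 0 s == u, last 0 s == v & nth 0 (abs_diffs s) 0 == d].

(* Dropping the head keeps the first edge, which carries the first difference, out of the
   surgeries. *)
Definition inner_edge (x y : nat) (s : seq nat) : bool :=
  infix [:: x; y] (behead s) || infix [:: y; x] (behead s).

(** Since [w <= S], exactly [S] vertices are to be covered, as many as [s] has entries. *)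
Lemma punctured_path_perm S u v w g d s :
  w <= S -> punctured_path S u v w g d s ->
  uniq s /\ s =i [seq z <- iota 0 S.+1 | z != w].
Proof.
move=> lewS /and5P[/eqP size_s /allP sub_s _ _ _].
have uniqV : uniq [seq z <- iota 0 S.+1 | z != w] by rewrite filter_uniq ?iota_uniq.
have sizeV : size [seq z <- iota 0 S.+1 | z != w] = S.
  rewrite size_filter; have := count_predC (pred1 w) (iota 0 S.+1).
  rewrite (count_uniq_mem _ (iota_uniq _ _)) mem_iota size_iota /= add0n ltnS lewS.
  by rewrite -[count (predC _) _]/(count (fun z => z != w) _) => -[].
have [eq_size eqV] := uniq_min_size uniqV sub_s (eq_leq (etrans size_s (esym sizeV))).
by split=> [|z]; [rewrite -(eq_uniq eq_size eqV) | rewrite eqV].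
Qed.

(** * Replacing an inner edge by a path through new vertices *)

Section Insertion.

Variables (S' S m u v w d g' g : nat).
Hypotheses (le_w : w <= S') (le_m : m + S' <= S).

Let flip z := S' + m - z.

(** Reflection preserves differences, so cutting the edge {x, y} loses only [absdiff x y]; the
    detour through [O] from [flip x] to [flip y] has to supply whatever the old path does not. As
    [flip] carries {0, ..., S'} onto {m, ..., m + S'}, there are [m] new vertices below and the
    others lie above. *)
Lemma insert_oriented (s : seq nat) (x y : nat) (O : seq nat) :
    punctured_path S' u v w g' d s -> infix [:: x; y] (behead s) ->
    size O = S - S' ->
    (forall z, z <= S -> z < m \/ m + S' < z -> z \in O) ->
    (forall e, 0 < e <= S -> e != g ->
       [&& e <= S', e != g' & e != absdiff x y]
       || (e \in abs_diffs (flip x :: rcons O (flip y)))) ->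
  exists s2, punctured_path S (flip u) (flip v) (flip w) g d s2 /\
    forall a b, infix [:: a; b] O -> inner_edge a b s2.
Proof.
move=> path_s xy_s sizeO vertO diffO.
have [uniq_s mem_s] := punctured_path_perm le_w path_s.
have les z : z \in s -> z <= S' by rewrite mem_s mem_filter mem_iota; lia.
case/and5P: path_s => /eqP size_s _ /allP diff_s /eqP head_s.
case/andP=> /eqP last_s /eqP fst_s.
have [A [B]] : exists A B : seq nat, behead s = A ++ [:: x; y] ++ B by apply/infixP.
case: s {xy_s} uniq_s mem_s les size_s diff_s head_s last_s fst_s
  => [|u0 s] + + + + + + + + /= Es.
  by case: A Es.
move=> uniq_s mem_s les size_s diff_s Eu last_s fst_s.
(* [A] may be empty, but [A0] contains the head: the first edge of the path stays to the left of the
   cut. *)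
have [A0 EA0] : exists A0, A0 = u0 :: A by exists (u0 :: A).
have Es0 : u0 :: s = A0 ++ x :: y :: B by rewrite EA0 Es.
rewrite Es0 in uniq_s mem_s les size_s diff_s last_s fst_s.
have leA z : z \in rcons A0 x -> z <= S'.
  by move=> zA; apply: les; rewrite -cat_rcons mem_cat zA.
have leB z : z \in y :: B -> z <= S'.
  by move=> zB; apply: les; rewrite -cat_rcons mem_cat zB orbT.
have lec t : (forall z, z \in t -> z <= S') -> all (fun a => a <= S' + m) t.
  by move=> le_t; apply/allP => z /le_t; lia.
have dA : abs_diffs (rcons (map flip A0) (flip x)) = abs_diffs (rcons A0 x).
  by rewrite -map_rcons abs_diffs_subl ?lec.
have dB : abs_diffs (flip y :: map flip B) = abs_diffs (y :: B).
  by rewrite -map_cons abs_diffs_subl ?lec.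
(* The surgery: both pieces are reflected, and [O] takes the place of the cut edge. *)
pose s2 := map flip A0 ++ flip x :: O ++ flip y :: map flip B.
have ds2 : abs_diffs s2 = abs_diffs (rcons A0 x) ++
    abs_diffs (flip x :: rcons O (flip y)) ++ abs_diffs (y :: B).
  by rewrite /s2 abs_diffs_cat dA -cat_cons abs_diffs_cat dB.
have ds : abs_diffs (A0 ++ x :: y :: B) =
    abs_diffs (rcons A0 x) ++ absdiff y x :: abs_diffs (y :: B).
  by rewrite abs_diffs_cat.
have mem_s2 z : z \in A0 ++ x :: y :: B -> flip z \in s2.
  rewrite /s2 !(mem_cat, in_cons) => /or4P[zA|/eqP->|/eqP->|zB].
  - by rewrite (map_f flip zA).
  - by rewrite eqxx !orbT.
  - by rewrite eqxx !orbT.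
  - by rewrite (map_f flip zB) !orbT.
exists s2; split; last first.
  move=> a b /infixP[O1 [O2 EO]]; apply/orP; left; apply/infixP.
  exists (map flip A ++ flip x :: O1), (O2 ++ flip y :: map flip B).
  by rewrite /s2 EA0 EO /= -!catA.
have sizeAB : size A0 + (size B).+2 = S' by rewrite -size_s size_cat.
apply/and5P; split.
- by apply/eqP; rewrite /s2 size_cat /= size_cat /= !size_map; lia.
- apply/allP => z; rewrite mem_filter mem_iota => zP.
  (* A vertex outside the reflected interval is in [O]; inside it [flip] is an involution, so the
     vertex comes from [s]. *)
  have [zO|zI] : (z < m \/ m + S' < z) \/ (m <= z <= m + S') by lia.
    have zinO : z \in O by apply: vertO zO; lia.
    by rewrite /= /s2 mem_cat in_cons mem_cat zinO !orbT.
  have -> : z = flip (flip z) by rewrite /flip; lia.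
  apply: mem_s2; rewrite mem_s mem_filter mem_iota.
  by move: zP; rewrite /flip; lia.
- apply/allP => e; rewrite mem_filter mem_iota => eP.
  have [/and3P[leS' neg' nexy]|eO] := orP (diffO e ltac:(lia) ltac:(lia)).
    have: e \in abs_diffs (A0 ++ x :: y :: B).
      by apply: diff_s; rewrite mem_filter mem_iota neg'; lia.
    rewrite ds mem_cat in_cons absdiffC (negPf nexy) /= => eAB.
    by rewrite /= ds2 !mem_cat; case/orP: eAB => ->; rewrite ?orbT.
  by rewrite /= ds2 !mem_cat eO orbT.
- by apply/eqP; rewrite /s2 EA0 -Eu.
- rewrite /s2 last_cat /= last_cat /= last_map.
  move: last_s; rewrite last_cat /= => ->; rewrite eqxx /=.
  (* The left block has at least one difference, so difference number 0 is the old one. *)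
  have size_dA : 0 < size (abs_diffs (rcons A0 x)) by rewrite size_abs_diffs size_rcons EA0.
  rewrite ds2 nth_cat size_dA; apply/eqP.
  by move: fst_s; rewrite ds nth_cat size_dA.
Qed.

(** If [s] traverses the edge from [y] to [x], inserting [rev O] gives the same vertices and the
    same differences. *)
Lemma insert (s : seq nat) (x y : nat) (O : seq nat) :
    punctured_path S' u v w g' d s -> inner_edge x y s ->
    size O = S - S' ->
    (forall z, z <= S -> z < m \/ m + S' < z -> z \in O) ->
    (forall e, 0 < e <= S -> e != g ->
       [&& e <= S', e != g' & e != absdiff x y]
       || (e \in abs_diffs (flip x :: rcons O (flip y)))) ->
  exists s2, punctured_path S (flip u) (flip v) (flip w) g d s2 /\
    forall a b, infix [:: a; b] O -> inner_edge a b s2.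
Proof.
move=> path_s /orP[] xy_s sizeO vertO diffO; first exact: insert_oriented xy_s _ _ _.
have [|z leS zO|e eP neg|s2 [path_s2 edge_s2]] :=
  insert_oriented (O := rev O) path_s xy_s.
- by rewrite size_rev.
- by rewrite mem_rev; apply: vertO.
- by rewrite -rev_cons -rev_rcons abs_diffs_rev mem_rev rcons_cons absdiffC diffO.
exists s2; split=> // a b /infixP[O1 [O2 EO]].
rewrite /inner_edge orbC; apply: edge_s2; apply/infixP.
by exists (rev O2), (rev O1); rewrite EO !rev_cat /= -catA.
Qed.

End Insertion.

(** * Zigzags *)

(** With [q] well below [p], consecutive differences are p - q, p - q - 1, p - q - 2, and so on. *)
Fixpoint zigzag (p q n : nat) : seq nat :=
  if n is n'.+1 then p :: q :: zigzag p.-1 q.+1 n' else [::].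

Lemma zigzag0 p q : zigzag p q 0 = [::].
Proof. by []. Qed.

Lemma zigzagS p q n : zigzag p q n.+1 = [:: p, q & zigzag p.-1 q.+1 n].
Proof. by []. Qed.

Lemma size_zigzag p q n : size (zigzag p q n) = n.*2.
Proof. by elim: n p q => //= n IHn p q; rewrite IHn. Qed.

(** The bound on [n] keeps the descending vertices from being truncated at 0. *)
Lemma mem_zigzag p q n z : n <= p.+1 ->
  (z \in zigzag p q n) = (p < z + n) && (z <= p) || (q <= z < q + n).
Proof.
elim: n p q => [|[|n] IHn] p q lenp; [rewrite in_nil| rewrite !inE |]; try lia.
by rewrite zigzagS 2!in_cons IHn; lia.
Qed.

Lemma last_zigzag x p q n : last x (zigzag p q n.+1) = q + n.
Proof.
elim: n x p q => [|n IHn] x p q; first by rewrite /= addn0.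
by rewrite zigzagS 2!last_cons IHn addSnnS.
Qed.

Lemma eq_absdiff c a b : (c == absdiff a b) = (a == b + c) || (b == a + c).
Proof. by rewrite /absdiff; lia. Qed.

(** The [n.+1] pairs have 2n + 1 inner differences, the whole interval from p - q - 2n to p - q; the
    hypothesis makes its lower end nonnegative. The entry from [x] adds one more. *)
Lemma mem_diffs_zigzag x p q n e : q + n.*2 <= p ->
  (e \in pairmap (fun a b => absdiff b a) x (zigzag p q n.+1)) =
  (e == absdiff p x) || (p <= e + q + n.*2) && (e + q <= p).
Proof.
elim: n x p q => [|n IHn] x p q le_pq; first by rewrite zigzagS zigzag0 /= !inE !eq_absdiff; lia.
have := IHn q p.-1 q.+1; rewrite zigzagS; move: (zigzag p.-1 q.+1 n.+1) => t IH.
by rewrite /= 2!in_cons IH ?eq_absdiff; lia.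
Qed.

#[local] Opaque zigzag.

(** * Extending anchored paths *)

(* [e] stands for the parity [~~ odd h]; [b] tells whether the path starts at [h + 1]. *)
Definition anchored (e b : bool) (h d : nat) (s : seq nat) : bool :=
  punctured_path h.*2.+1 (if b then h.+1 else h.-1) h (if b then h - 2 else h + 2)
    (if e then h.*2 else h.*2.+1) d s
  && (if e then inner_edge 0 h.*2.+1 s && inner_edge 0 h.*2.-1 s
      else inner_edge 0 h.*2 s).

(** This is [insert] with m = h - h' - 1, so that the reflection is z -> h + h' - z. It fixes the
    offset form of the ends and of the gap up to sign: h' goes to h, h' + 1 to h - 1, h' - 2 to h +
    2, and conversely, which is why [b] is negated. *)
Lemma extend (e e' b : bool) (h' h d x y x' y' : nat) (O : seq nat) :
    2 <= h' < h -> x' + x = h + h' -> y' + y = h + h' ->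
    (forall s, anchored e' b h' d s -> inner_edge x y s) ->
    size O + h'.*2 = h.*2 ->
    (forall z, z <= h.*2.+1 -> (z + h').+1 < h \/ h + h' < z -> z \in O) ->
    (forall c, 0 < c <= h.*2.+1 -> c != (if e then h.*2 else h.*2.+1) ->
       [&& c <= h'.*2.+1, c != (if e' then h'.*2 else h'.*2.+1) & c != absdiff x y]
       || (c \in abs_diffs (x' :: rcons O y'))) ->
    infix (if e then [:: h.*2.+1; 0; h.*2.-1] else [:: h.*2; 0]) O ->
  (exists s, anchored e' b h' d s) -> exists s, anchored e (~~ b) h d s.
Proof.
move=> /andP[le2h' lth] x'E y'E edge_xy sizeO vertO diffO edgeO [s s_anch].
have flipE z : h'.*2.+1 + (h - h').-1 - z = h + h' - z by lia.
have /andP[path_s _] := s_anch.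
have [||||c le_c c_g|s2 [path_s2 edge_s2]] :=
  insert (S := h.*2.+1) (m := (h - h').-1) (g := if e then h.*2 else h.*2.+1)
    (O := O) _ _ path_s (edge_xy s s_anch).
- by case: b {edge_xy path_s s_anch} => /=; lia.
- by lia.
- by lia.
- by move=> z le_z z_out; apply: vertO; lia.
- by rewrite !flipE -x'E addnK x'E -y'E addnK; apply: diffO.
exists s2; rewrite /anchored; apply/andP; split.
  move: path_s2; rewrite !flipE.
  have -> : h + h' - h' = h by lia.
  have -> : h + h' - (if b then h'.+1 else h'.-1) = if ~~ b then h.+1 else h.-1.
    by case: b {edge_xy path_s s_anch} => /=; lia.
  have -> // : h + h' - (if b then h' - 2 else h' + 2) = if ~~ b then h - 2 else h + 2.
  by case: b {edge_xy path_s s_anch} => /=; lia.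
case: e edgeO {vertO diffO path_s2} => /infixP[O1 [O2 EO]].
  apply/andP; split; rewrite /inner_edge orbC; last rewrite orbC; apply: edge_s2; apply/infixP.
    by exists O1, (h.*2.-1 :: O2).
  by exists (rcons O1 h.*2.+1), O2; rewrite cat_rcons.
by rewrite /inner_edge orbC; apply: edge_s2; apply/infixP; exists O1, O2.
Qed.

Lemma inner_edgeC x y s : inner_edge x y s = inner_edge y x s.
Proof. exact: orbC. Qed.

Lemma even_top_edge b h d s : anchored true b h d s -> inner_edge h.*2.+1 0 s.
Proof. by rewrite inner_edgeC => /andP[_ /andP[]]. Qed.

Lemma even_next_edge b h d s : anchored true b h d s -> inner_edge h.*2.-1 0 s.
Proof. by rewrite inner_edgeC => /andP[_ /andP[]]. Qed.

Lemma odd_top_edge b h d s : anchored false b h d s -> inner_edge h.*2 0 s.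
Proof. by rewrite inner_edgeC => /andP[_]. Qed.

Lemma infix_zigzag A B p q n a : 0 < n -> a = p ->
  infix [:: a; q] (A ++ zigzag p q n ++ B).
Proof.
by case: n => // n _ ->; apply/infixP; exists A, (zigzag p.-1 q.+1 n ++ B); rewrite zigzagS.
Qed.

Lemma infix_pair_zigzag A B c c' p q n a b : 0 < n -> a = c -> b = p ->
  infix [:: a; c'; b] (A ++ [:: c; c'] ++ zigzag p q n ++ B).
Proof.
case: n => // n _ -> ->; apply/infixP.
by exists A, (q :: zigzag p.-1 q.+1 n ++ B); rewrite zigzagS.
Qed.

(** The tactics match the premises of [extend] in order. Zigzag vertices and differences become
    intervals, which leaves linear arithmetic in [k]. *)
Ltac outer_path :=
  [> lia | lia | lia
   | first [exact: even_top_edge | exact: even_next_edge | exact: odd_top_edge]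
   | rewrite !size_cat !size_zigzag /=; lia
   | move=> ?; rewrite !mem_cat ?in_cons !mem_zigzag ?in_nil; lia
   | move=> ?; rewrite -cats1 -?catA /= ?(pairmap_cat, last_zigzag) /=
       ?(pairmap_cat, last_zigzag) /=;
     rewrite ?(mem_cat, mem_diffs_zigzag, in_cons, in_nil, eq_absdiff); lia
   | (apply: infix_zigzag || apply: infix_pair_zigzag); lia ].

(** * The ten surgeries, with h' = k + 2 *)

(** Cutting {0, 2h' + 1} leaves 1, ..., 2k + 3. The zigzags realize 6k + 16, ..., 10k + 22 and 2k +
    7, ..., 6k + 13; their link gives 6k + 14 and the exit 2k + 6. The two extra vertices at the
    start give 6k + 15, 2k + 5 and 2k + 4. *)
Lemma even_to_odd_5h_plus1 (b : bool) (k d : nat) : 3 <= k ->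
  (exists s, anchored true b (k + 2) d s) -> exists s, anchored false (~~ b) (5 * k + 11) d s.
Proof.
move=> le3k; apply: (@extend _ _ _ _ _ _ ((k + 2).*2.+1) 0 (4 * k + 8) (6 * k + 13)
  ([:: 10 * k + 23; 8 * k + 18]
    ++ zigzag (10 * k + 22) 0 ((2 * k + 3).+1)
    ++ [::]
    ++ zigzag (8 * k + 17) (2 * k + 4) ((2 * k + 3).+1))).
all: outer_path.
Qed.

(** Here the two extra vertices sit between the zigzags, and again restore 2k + 4 and 2k + 5. *)
Lemma even_to_odd_5h_minus1 (b : bool) (k d : nat) : 3 <= k ->
  (exists s, anchored true b (k + 2) d s) -> exists s, anchored false (~~ b) (5 * k + 9) d s.
Proof.
move=> le3k; apply: (@extend _ _ _ _ _ _ ((k + 2).*2.+1) 0 (4 * k + 6) (6 * k + 11)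
  ([::]
    ++ zigzag (10 * k + 18) 0 ((2 * k + 2).+1)
    ++ [:: 8 * k + 15; 10 * k + 19]
    ++ zigzag (8 * k + 14) (2 * k + 3) ((2 * k + 2).+1))).
all: outer_path.
Qed.

(** The cut edge is {0, 2h' - 1}: the difference 2h' + 1 = 2k + 5 survives, and the detour gives 2k
    + 3, 2k + 4 and everything from 2k + 6 on. *)
Lemma even_to_odd_5h_minus3 (b : bool) (k d : nat) : 3 <= k ->
  (exists s, anchored true b (k + 2) d s) -> exists s, anchored false (~~ b) (5 * k + 7) d s.
Proof.
move=> le3k; apply: (@extend _ _ _ _ _ _ ((k + 2).*2.-1) 0 (4 * k + 6) (6 * k + 9)
  ([:: 10 * k + 15; 8 * k + 11]
    ++ zigzag (10 * k + 14) 0 ((2 * k + 2).+1)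
    ++ [::]
    ++ zigzag (8 * k + 10) (2 * k + 3) ((2 * k).+1))).
all: outer_path.
Qed.

(** For odd h' the cut edge {0, 2h'} has the largest old difference, so 1, ..., 2k + 3 survive. *)
Lemma odd_to_odd_5h (b : bool) (k d : nat) : 3 <= k ->
  (exists s, anchored false b (k + 2) d s) -> exists s, anchored false (~~ b) (5 * k + 10) d s.
Proof.
move=> le3k; apply: (@extend _ _ _ _ _ _ ((k + 2).*2) 0 (4 * k + 8) (6 * k + 12)
  ([:: 10 * k + 21; 8 * k + 16]
    ++ zigzag (10 * k + 20) 0 ((2 * k + 3).+1)
    ++ [::]
    ++ zigzag (8 * k + 15) (2 * k + 4) ((2 * k + 2).+1))).
all: outer_path.
Qed.

Lemma odd_to_odd_5h_minus2 (b : bool) (k d : nat) : 3 <= k ->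
  (exists s, anchored false b (k + 2) d s) -> exists s, anchored false (~~ b) (5 * k + 8) d s.
Proof.
move=> le3k; apply: (@extend _ _ _ _ _ _ ((k + 2).*2) 0 (4 * k + 6) (6 * k + 10)
  ([::]
    ++ zigzag (10 * k + 16) 0 ((2 * k + 2).+1)
    ++ [:: 8 * k + 13; 10 * k + 17]
    ++ zigzag (8 * k + 12) (2 * k + 3) ((2 * k + 1).+1))).
all: outer_path.
Qed.

(** For even targets 0 is taken out of the first zigzag and placed between 2h + 1 and 2h - 1; this
    creates both required edges and skips the difference 2h. *)
Lemma even_to_even_5h (b : bool) (k d : nat) : 3 <= k ->
  (exists s, anchored true b (k + 2) d s) -> exists s, anchored true (~~ b) (5 * k + 10) d s.
Proof.
move=> le3k; apply: (@extend _ _ _ _ _ _ ((k + 2).*2.+1) 0 (4 * k + 7) (6 * k + 12)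
  ([:: 10 * k + 20; 8 * k + 16]
    ++ [:: 10 * k + 21; 0]
    ++ zigzag (10 * k + 19) 1 ((2 * k + 2).+1)
    ++ [::]
    ++ zigzag (8 * k + 15) (2 * k + 4) ((2 * k + 2).+1))).
all: outer_path.
Qed.

Lemma even_to_even_5h_plus2 (b : bool) (k d : nat) : 3 <= k ->
  (exists s, anchored true b (k + 2) d s) -> exists s, anchored true (~~ b) (5 * k + 12) d s.
Proof.
move=> le3k; apply: (@extend _ _ _ _ _ _ ((k + 2).*2.+1) 0 (4 * k + 9) (6 * k + 14)
  ([::]
    ++ [:: 10 * k + 25; 0]
    ++ zigzag (10 * k + 23) 1 ((2 * k + 2).+1)
    ++ [:: 8 * k + 20; 10 * k + 24]
    ++ zigzag (8 * k + 19) (2 * k + 4) ((2 * k + 4).+1))).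
all: outer_path.
Qed.

Lemma even_to_even_5h_minus2 (b : bool) (k d : nat) : 3 <= k ->
  (exists s, anchored true b (k + 2) d s) -> exists s, anchored true (~~ b) (5 * k + 8) d s.
Proof.
move=> le3k; apply: (@extend _ _ _ _ _ _ ((k + 2).*2.-1) 0 (4 * k + 7) (6 * k + 10)
  ([::]
    ++ [:: 10 * k + 17; 0]
    ++ zigzag (10 * k + 15) 1 ((2 * k + 1).+1)
    ++ [:: 8 * k + 13; 10 * k + 16]
    ++ zigzag (8 * k + 12) (2 * k + 3) ((2 * k + 1).+1))).
all: outer_path.
Qed.

Lemma odd_to_even_5h_plus1 (b : bool) (k d : nat) : 3 <= k ->
  (exists s, anchored false b (k + 2) d s) -> exists s, anchored true (~~ b) (5 * k + 11) d s.
Proof.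
move=> le3k; apply: (@extend _ _ _ _ _ _ ((k + 2).*2) 0 (4 * k + 9) (6 * k + 13)
  ([::]
    ++ [:: 10 * k + 23; 0]
    ++ zigzag (10 * k + 21) 1 ((2 * k + 2).+1)
    ++ [:: 8 * k + 18; 10 * k + 22]
    ++ zigzag (8 * k + 17) (2 * k + 4) ((2 * k + 3).+1))).
all: outer_path.
Qed.

Lemma odd_to_even_5h_minus1 (b : bool) (k d : nat) : 3 <= k ->
  (exists s, anchored false b (k + 2) d s) -> exists s, anchored true (~~ b) (5 * k + 9) d s.
Proof.
move=> le3k; apply: (@extend _ _ _ _ _ _ ((k + 2).*2) 0 (4 * k + 7) (6 * k + 11)
  ([:: 10 * k + 18; 8 * k + 14]
    ++ [:: 10 * k + 19; 0]
    ++ zigzag (10 * k + 17) 1 ((2 * k + 2).+1)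
    ++ [::]
    ++ zigzag (8 * k + 13) (2 * k + 4) ((2 * k + 1).+1))).
all: outer_path.
Qed.

(** * Explicit small paths *)

(* Found by computer search; the three parameters of each path are read off by [path_key]. *)
Definition seeds : seq (seq nat) :=
  [:: [:: 2; 7; 6; 0; 4; 1; 3];
    [:: 4; 9; 0; 10; 8; 1; 2; 6; 3; 11; 5];
    [:: 4; 10; 0; 9; 1; 8; 11; 6; 2; 3; 5];
    [:: 4; 11; 6; 3; 2; 8; 10; 0; 9; 1; 5];
    [:: 6; 1; 8; 2; 10; 0; 9; 11; 7; 4; 5];
    [:: 6; 0; 10; 1; 9; 11; 4; 8; 7; 2; 5];
    [:: 5; 10; 1; 11; 0; 13; 7; 3; 2; 9; 12; 4; 6];
    [:: 5; 11; 0; 13; 10; 1; 9; 2; 12; 7; 3; 4; 6];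
    [:: 5; 12; 4; 10; 1; 11; 0; 13; 9; 7; 2; 3; 6];
    [:: 7; 2; 10; 12; 3; 9; 13; 0; 11; 1; 8; 5; 6];
    [:: 7; 1; 11; 0; 13; 9; 2; 10; 12; 3; 8; 5; 6];
    [:: 6; 1; 13; 0; 14; 4; 15; 11; 12; 3; 10; 2; 8; 5; 7];
    [:: 6; 0; 14; 1; 13; 2; 12; 3; 11; 15; 8; 10; 5; 4; 7];
    [:: 6; 13; 0; 14; 4; 15; 3; 5; 1; 10; 2; 8; 11; 12; 7];
    [:: 8; 3; 10; 9; 15; 11; 2; 12; 1; 13; 0; 14; 6; 4; 7];
    [:: 8; 2; 12; 1; 13; 0; 14; 15; 6; 10; 3; 11; 9; 4; 7];
    [:: 8; 1; 13; 0; 14; 4; 15; 10; 12; 9; 3; 11; 2; 6; 7];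
    [:: 7; 2; 14; 1; 15; 0; 17; 13; 6; 16; 5; 4; 12; 3; 9; 11; 8];
    [:: 7; 1; 12; 2; 16; 3; 15; 0; 17; 14; 6; 5; 9; 11; 4; 13; 8];
    [:: 7; 14; 17; 0; 15; 9; 5; 4; 13; 1; 12; 2; 16; 3; 11; 6; 8];
    [:: 9; 4; 7; 5; 11; 10; 17; 0; 15; 1; 14; 2; 13; 3; 12; 16; 8];
    [:: 9; 3; 13; 2; 14; 1; 15; 0; 17; 16; 7; 11; 4; 12; 10; 5; 8];
    [:: 9; 2; 16; 3; 15; 0; 17; 12; 1; 11; 14; 10; 4; 13; 5; 7; 8];
    [:: 8; 13; 7; 5; 12; 4; 14; 3; 15; 2; 16; 1; 17; 0; 18; 19; 10; 6; 9];
    [:: 8; 14; 6; 10; 7; 5; 0; 18; 1; 17; 2; 16; 3; 15; 4; 13; 12; 19; 9];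
    [:: 8; 1; 17; 0; 18; 16; 2; 15; 3; 14; 4; 19; 10; 7; 12; 6; 5; 13; 9];
    [:: 10; 5; 12; 6; 8; 11; 19; 18; 0; 17; 1; 16; 2; 15; 3; 14; 4; 13; 9];
    [:: 10; 4; 13; 11; 19; 14; 3; 15; 2; 16; 1; 17; 0; 18; 8; 12; 5; 6; 9];
    [:: 10; 3; 15; 2; 16; 1; 17; 0; 18; 8; 19; 14; 11; 13; 4; 12; 6; 5; 9];
    [:: 9; 14; 8; 6; 13; 5; 15; 4; 16; 3; 17; 2; 18; 1; 19; 0; 21; 20; 11; 7; 10];
    [:: 9; 15; 4; 16; 3; 17; 2; 18; 1; 19; 0; 21; 11; 20; 13; 8; 5; 7; 6; 14; 10];
    [:: 9; 2; 18; 1; 19; 0; 21; 13; 14; 20; 5; 15; 4; 16; 3; 17; 8; 6; 11; 7; 10];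
    [:: 11; 6; 13; 7; 9; 12; 20; 21; 0; 19; 1; 18; 2; 17; 3; 16; 4; 15; 5; 14; 10];
    [:: 11; 5; 14; 6; 13; 9; 7; 12; 15; 4; 16; 3; 17; 2; 18; 1; 19; 0; 21; 20; 10];
    [:: 11; 4; 16; 3; 17; 2; 18; 1; 19; 0; 21; 20; 9; 13; 15; 5; 14; 6; 12; 7; 10];
    [:: 10; 5; 17; 4; 18; 3; 19; 2; 20; 1; 21; 0; 22; 12; 23; 16; 14; 8; 9; 6; 15; 7; 11];
    [:: 10; 16; 5; 17; 4; 18; 3; 19; 2; 20; 1; 21; 0; 22; 12; 9; 14; 23; 15; 8; 6; 7; 11];
    [:: 10; 3; 19; 2; 20; 1; 21; 0; 22; 7; 8; 12; 6; 16; 5; 17; 4; 18; 15; 23; 14; 9; 11];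
    [:: 12; 7; 15; 8; 14; 23; 22; 0; 21; 1; 20; 2; 19; 3; 18; 4; 17; 5; 16; 6; 10; 13; 11];
    [:: 12; 6; 16; 5; 17; 4; 18; 3; 19; 2; 20; 1; 21; 0; 22; 23; 14; 10; 7; 15; 8; 13; 11];
    [:: 12; 5; 16; 6; 14; 23; 17; 4; 18; 3; 19; 2; 20; 1; 21; 0; 22; 10; 7; 8; 13; 15; 11];
    [:: 11; 16; 24; 15; 25; 0; 23; 1; 22; 2; 21; 3; 20; 4; 19; 5; 18; 6; 17; 10; 13; 7; 9; 8; 12];
    [:: 11; 17; 6; 18; 5; 19; 4; 20; 3; 21; 2; 22; 1; 23; 0; 25; 15; 24; 16; 9; 13; 10; 8; 7; 12];
    [:: 11; 4; 20; 3; 21; 2; 22; 1; 23; 0; 25; 24; 9; 15; 19; 5; 18; 6; 17; 7; 16; 8; 13; 10; 12];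
    [:: 13; 8; 16; 9; 15; 24; 25; 0; 23; 1; 22; 2; 21; 3; 20; 4; 19; 5; 18; 6; 17; 7; 11; 14; 12];
    [:: 13; 7; 17; 6; 18; 5; 19; 4; 20; 3; 21; 2; 22; 1; 23; 0; 25; 24; 15; 11; 8; 16; 9; 14; 12];
    [:: 13; 6; 18; 5; 19; 4; 20; 3; 21; 2; 22; 1; 23; 0; 25; 14; 24; 16; 7; 11; 8; 9; 15; 17; 12];
    [:: 12; 7; 19; 6; 20; 5; 21; 4; 22; 3; 23; 2; 24; 1; 25; 0; 26; 16; 27; 18; 11; 10; 8; 14; 17;
     9; 13];
    [:: 12; 18; 27; 16; 26; 0; 25; 1; 24; 2; 23; 3; 22; 4; 21; 5; 20; 6; 19; 7; 11; 8; 10; 17; 9;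
     14; 13];
    [:: 12; 19; 7; 20; 6; 21; 5; 22; 4; 23; 3; 24; 2; 25; 1; 26; 0; 9; 10; 8; 16; 27; 17; 11; 14;
     18; 13];
    [:: 14; 9; 15; 8; 17; 27; 26; 0; 25; 1; 24; 2; 23; 3; 22; 4; 21; 5; 20; 6; 19; 7; 18; 10; 12;
     16; 13];
    [:: 14; 8; 16; 12; 9; 18; 7; 19; 6; 20; 5; 21; 4; 22; 3; 23; 2; 24; 1; 25; 0; 26; 27; 17; 10;
     15; 13];
    [:: 14; 7; 19; 6; 20; 5; 21; 4; 22; 3; 23; 2; 24; 1; 25; 0; 26; 16; 27; 18; 12; 8; 9; 17; 15;
     10; 13];
    [:: 13; 8; 20; 7; 21; 6; 22; 5; 23; 4; 24; 3; 25; 2; 26; 1; 27; 0; 29; 18; 28; 19; 15; 9; 17;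
     10; 12; 11; 14];
    [:: 13; 19; 28; 18; 29; 0; 27; 1; 26; 2; 25; 3; 24; 4; 23; 5; 22; 6; 21; 7; 20; 8; 15; 12; 17;
     9; 11; 10; 14];
    [:: 13; 20; 7; 21; 6; 22; 5; 23; 4; 24; 3; 25; 2; 26; 1; 27; 0; 29; 17; 28; 18; 9; 12; 11; 19;
     15; 10; 8; 14];
    [:: 15; 10; 16; 9; 18; 28; 29; 0; 27; 1; 26; 2; 25; 3; 24; 4; 23; 5; 22; 6; 21; 7; 20; 8; 19;
     11; 13; 17; 14];
    [:: 15; 9; 17; 13; 10; 19; 8; 20; 7; 21; 6; 22; 5; 23; 4; 24; 3; 25; 2; 26; 1; 27; 0; 29; 28;
     18; 11; 16; 14];
    [:: 15; 8; 20; 7; 21; 6; 22; 5; 23; 4; 24; 3; 25; 2; 26; 1; 27; 0; 29; 18; 28; 19; 16; 10; 11;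
     13; 17; 9; 14];
    [:: 14; 9; 18; 10; 11; 13; 16; 12; 19; 31; 20; 30; 0; 29; 1; 28; 2; 27; 3; 26; 4; 25; 5; 24;
     6; 23; 7; 22; 8; 21; 15];
    [:: 14; 8; 22; 7; 23; 6; 24; 5; 25; 4; 26; 3; 27; 2; 28; 1; 29; 0; 30; 21; 16; 13; 20; 9; 19;
     31; 18; 10; 12; 11; 15];
    [:: 14; 21; 8; 22; 7; 23; 6; 24; 5; 25; 4; 26; 3; 27; 2; 28; 1; 29; 0; 30; 20; 31; 19; 13; 16;
     12; 11; 9; 18; 10; 15];
    [:: 16; 11; 17; 9; 18; 21; 8; 22; 7; 23; 6; 24; 5; 25; 4; 26; 3; 27; 2; 28; 1; 29; 0; 30; 20;
     31; 19; 12; 10; 14; 15];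
    [:: 16; 10; 17; 9; 18; 21; 8; 22; 7; 23; 6; 24; 5; 25; 4; 26; 3; 27; 2; 28; 1; 29; 0; 30; 20;
     31; 19; 14; 12; 11; 15];
    [:: 16; 9; 18; 10; 11; 17; 21; 8; 22; 7; 23; 6; 24; 5; 25; 4; 26; 3; 27; 2; 28; 1; 29; 0; 30;
     20; 31; 19; 14; 12; 15];
    [:: 15; 10; 22; 9; 23; 8; 24; 7; 25; 6; 26; 5; 27; 4; 28; 3; 29; 2; 30; 1; 31; 0; 33; 32; 21;
     11; 20; 12; 19; 13; 17; 14; 16];
    [:: 15; 9; 23; 8; 24; 7; 25; 6; 26; 5; 27; 4; 28; 3; 29; 2; 30; 1; 31; 0; 33; 20; 32; 21; 11;
     13; 14; 22; 19; 10; 17; 12; 16];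
    [:: 15; 8; 24; 7; 25; 6; 26; 5; 27; 4; 28; 3; 29; 2; 30; 1; 31; 0; 33; 32; 17; 20; 12; 21; 11;
     22; 10; 23; 9; 13; 19; 14; 16];
    [:: 17; 12; 18; 11; 20; 10; 22; 9; 23; 8; 24; 7; 25; 6; 26; 5; 27; 4; 28; 3; 29; 2; 30; 1; 31;
     0; 33; 32; 21; 13; 15; 19; 16];
    [:: 17; 11; 19; 15; 12; 21; 32; 33; 0; 31; 1; 30; 2; 29; 3; 28; 4; 27; 5; 26; 6; 25; 7; 24; 8;
     23; 9; 22; 10; 20; 13; 18; 16];
    [:: 17; 10; 22; 9; 23; 8; 24; 7; 25; 6; 26; 5; 27; 4; 28; 3; 29; 2; 30; 1; 31; 0; 33; 32; 21;
     11; 20; 12; 18; 13; 15; 19; 16];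
    [:: 16; 11; 20; 10; 24; 9; 25; 8; 26; 7; 27; 6; 28; 5; 29; 4; 30; 3; 31; 2; 32; 1; 33; 0; 34;
     23; 35; 22; 15; 14; 12; 18; 21; 13; 17];
    [:: 16; 10; 24; 9; 25; 8; 26; 7; 27; 6; 28; 5; 29; 4; 30; 3; 31; 2; 32; 1; 33; 0; 34; 23; 35;
     22; 18; 15; 13; 14; 21; 11; 20; 12; 17];
    [:: 16; 9; 25; 8; 26; 7; 27; 6; 28; 5; 29; 4; 30; 3; 31; 2; 32; 1; 33; 0; 34; 35; 20; 15; 13;
     21; 12; 22; 11; 23; 10; 24; 18; 14; 17];
    [:: 18; 13; 12; 16; 22; 35; 23; 34; 0; 33; 1; 32; 2; 31; 3; 30; 4; 29; 5; 28; 6; 27; 7; 26; 8;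
     25; 9; 24; 10; 20; 11; 19; 21; 14; 17];
    [:: 18; 12; 16; 13; 14; 21; 19; 11; 20; 10; 24; 9; 25; 8; 26; 7; 27; 6; 28; 5; 29; 4; 30; 3;
     31; 2; 32; 1; 33; 0; 34; 23; 35; 22; 17];
    [:: 18; 11; 20; 10; 24; 9; 25; 8; 26; 7; 27; 6; 28; 5; 29; 4; 30; 3; 31; 2; 32; 1; 33; 0; 34;
     23; 35; 22; 16; 12; 13; 21; 19; 14; 17];
    [:: 17; 12; 19; 13; 22; 11; 21; 25; 10; 26; 9; 27; 8; 28; 7; 29; 6; 30; 5; 31; 4; 32; 3; 33;
     2; 34; 1; 35; 0; 37; 23; 36; 24; 16; 14; 15; 18];
    [:: 17; 11; 19; 15; 22; 36; 37; 0; 35; 1; 34; 2; 33; 3; 32; 4; 31; 5; 30; 6; 29; 7; 28; 8; 27;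
     9; 26; 10; 25; 12; 24; 13; 23; 14; 16; 21; 18];
    [:: 17; 10; 26; 9; 27; 8; 28; 7; 29; 6; 30; 5; 31; 4; 32; 3; 33; 2; 34; 1; 35; 0; 37; 36; 21;
     16; 14; 22; 13; 23; 12; 24; 11; 25; 19; 15; 18];
    [:: 19; 14; 20; 17; 21; 13; 15; 24; 11; 23; 12; 22; 36; 37; 0; 35; 1; 34; 2; 33; 3; 32; 4; 31;
     5; 30; 6; 29; 7; 28; 8; 27; 9; 26; 10; 25; 18];
    [:: 19; 13; 23; 12; 24; 11; 20; 25; 10; 26; 9; 27; 8; 28; 7; 29; 6; 30; 5; 31; 4; 32; 3; 33;
     2; 34; 1; 35; 0; 37; 36; 22; 14; 21; 17; 15; 18];
    [:: 19; 12; 21; 11; 22; 14; 15; 13; 17; 20; 25; 10; 26; 9; 27; 8; 28; 7; 29; 6; 30; 5; 31; 4;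
     32; 3; 33; 2; 34; 1; 35; 0; 37; 23; 36; 24; 18];
    [:: 18; 13; 15; 24; 39; 25; 38; 0; 37; 1; 36; 2; 35; 3; 34; 4; 33; 5; 32; 6; 31; 7; 30; 8; 29;
     9; 28; 10; 27; 11; 23; 12; 22; 14; 17; 16; 20; 26; 19];
    [:: 18; 12; 26; 13; 25; 14; 24; 39; 38; 0; 37; 1; 36; 2; 35; 3; 34; 4; 33; 5; 32; 6; 31; 7;
     30; 8; 29; 9; 28; 10; 27; 11; 20; 16; 23; 15; 17; 22; 19];
    [:: 18; 11; 27; 10; 28; 9; 29; 8; 30; 7; 31; 6; 32; 5; 33; 4; 34; 3; 35; 2; 36; 1; 37; 0; 38;
     25; 39; 24; 12; 23; 13; 16; 15; 20; 14; 22; 26; 17; 19];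
    [:: 20; 15; 18; 22; 16; 23; 21; 12; 26; 13; 25; 14; 24; 39; 38; 0; 37; 1; 36; 2; 35; 3; 34; 4;
     33; 5; 32; 6; 31; 7; 30; 8; 29; 9; 28; 10; 27; 11; 19];
    [:: 20; 14; 18; 15; 16; 21; 13; 22; 12; 23; 11; 27; 10; 28; 9; 29; 8; 30; 7; 31; 6; 32; 5; 33;
     4; 34; 3; 35; 2; 36; 1; 37; 0; 38; 25; 39; 24; 26; 19];
    [:: 20; 13; 22; 12; 23; 11; 27; 10; 28; 9; 29; 8; 30; 7; 31; 6; 32; 5; 33; 4; 34; 3; 35; 2;
     36; 1; 37; 0; 38; 25; 39; 24; 26; 18; 14; 15; 21; 16; 19];
    [:: 19; 14; 23; 13; 24; 12; 28; 11; 29; 10; 30; 9; 31; 8; 32; 7; 33; 6; 34; 5; 35; 4; 36; 3;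
     37; 2; 38; 1; 39; 0; 41; 26; 40; 27; 21; 18; 25; 17; 15; 16; 20];
    [:: 19; 13; 27; 14; 26; 15; 25; 40; 41; 0; 39; 1; 38; 2; 37; 3; 36; 4; 35; 5; 34; 6; 33; 7;
     32; 8; 31; 9; 30; 10; 29; 11; 28; 12; 21; 17; 24; 16; 18; 23; 20];
    [:: 19; 12; 28; 11; 29; 10; 30; 9; 31; 8; 32; 7; 33; 6; 34; 5; 35; 4; 36; 3; 37; 2; 38; 1; 39;
     0; 41; 26; 40; 27; 21; 17; 16; 18; 15; 23; 14; 24; 13; 25; 20];
    [:: 21; 16; 19; 23; 17; 24; 22; 13; 27; 14; 26; 15; 25; 40; 41; 0; 39; 1; 38; 2; 37; 3; 36; 4;
     35; 5; 34; 6; 33; 7; 32; 8; 31; 9; 30; 10; 29; 11; 28; 12; 20];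
    [:: 21; 15; 22; 19; 14; 23; 13; 24; 12; 28; 11; 29; 10; 30; 9; 31; 8; 32; 7; 33; 6; 34; 5; 35;
     4; 36; 3; 37; 2; 38; 1; 39; 0; 41; 26; 40; 27; 25; 17; 16; 20];
    [:: 21; 14; 23; 13; 24; 12; 28; 11; 29; 10; 30; 9; 31; 8; 32; 7; 33; 6; 34; 5; 35; 4; 36; 3;
     37; 2; 38; 1; 39; 0; 41; 26; 40; 27; 25; 17; 16; 22; 19; 15; 20];
    [:: 20; 15; 17; 26; 13; 25; 14; 24; 16; 19; 18; 22; 29; 12; 30; 11; 31; 10; 32; 9; 33; 8; 34;
     7; 35; 6; 36; 5; 37; 4; 38; 3; 39; 2; 40; 1; 41; 0; 42; 28; 43; 27; 21];
    [:: 20; 14; 12; 13; 22; 18; 25; 43; 26; 42; 0; 41; 1; 40; 2; 39; 3; 38; 4; 37; 5; 36; 6; 35;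
     7; 34; 8; 33; 9; 32; 10; 31; 11; 30; 15; 29; 16; 28; 17; 27; 19; 24; 21];
    [:: 20; 13; 26; 14; 25; 15; 24; 29; 12; 30; 11; 31; 10; 32; 9; 33; 8; 34; 7; 35; 6; 36; 5; 37;
     4; 38; 3; 39; 2; 40; 1; 41; 0; 42; 28; 43; 27; 19; 22; 16; 18; 17; 21];
    [:: 22; 17; 18; 20; 16; 23; 15; 24; 14; 25; 13; 26; 29; 12; 30; 11; 31; 10; 32; 9; 33; 8; 34;
     7; 35; 6; 36; 5; 37; 4; 38; 3; 39; 2; 40; 1; 41; 0; 42; 28; 43; 27; 21];
    [:: 22; 16; 20; 27; 43; 28; 42; 0; 41; 1; 40; 2; 39; 3; 38; 4; 37; 5; 36; 6; 35; 7; 34; 8; 33;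
     9; 32; 10; 31; 11; 30; 12; 29; 24; 14; 25; 13; 26; 17; 18; 15; 23; 21];
    [:: 22; 15; 24; 14; 25; 13; 26; 20; 17; 16; 18; 23; 27; 43; 28; 42; 0; 41; 1; 40; 2; 39; 3;
     38; 4; 37; 5; 36; 6; 35; 7; 34; 8; 33; 9; 32; 10; 31; 11; 30; 12; 29; 21];
    [:: 21; 16; 18; 17; 20; 29; 44; 28; 45; 0; 43; 1; 42; 2; 41; 3; 40; 4; 39; 5; 38; 6; 37; 7;
     36; 8; 35; 9; 34; 10; 33; 11; 32; 12; 31; 13; 27; 14; 26; 15; 25; 19; 23; 30; 22];
    [:: 21; 15; 31; 16; 30; 17; 29; 18; 28; 19; 14; 13; 20; 12; 32; 11; 33; 10; 34; 9; 35; 8; 36;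
     7; 37; 6; 38; 5; 39; 4; 40; 3; 41; 2; 42; 1; 43; 0; 45; 26; 44; 27; 23; 25; 22];
    [:: 21; 14; 12; 32; 11; 33; 10; 34; 9; 35; 8; 36; 7; 37; 6; 38; 5; 39; 4; 40; 3; 41; 2; 42; 1;
     43; 0; 45; 26; 44; 27; 23; 15; 31; 16; 30; 17; 29; 18; 28; 25; 20; 19; 13; 22];
    [:: 23; 18; 24; 17; 21; 19; 16; 25; 15; 26; 14; 27; 13; 31; 12; 32; 11; 33; 10; 34; 9; 35; 8;
     36; 7; 37; 6; 38; 5; 39; 4; 40; 3; 41; 2; 42; 1; 43; 0; 45; 28; 44; 29; 30; 22];
    [:: 23; 17; 21; 30; 29; 44; 28; 45; 0; 43; 1; 42; 2; 41; 3; 40; 4; 39; 5; 38; 6; 37; 7; 36; 8;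
     35; 9; 34; 10; 33; 11; 32; 12; 31; 13; 27; 14; 26; 15; 25; 18; 16; 24; 19; 22];
    [:: 23; 16; 19; 21; 30; 24; 29; 44; 28; 45; 0; 43; 1; 42; 2; 41; 3; 40; 4; 39; 5; 38; 6; 37;
     7; 36; 8; 35; 9; 34; 10; 33; 11; 32; 12; 31; 13; 27; 14; 26; 15; 25; 17; 18; 22];
    [:: 22; 15; 29; 16; 28; 17; 27; 21; 24; 19; 20; 18; 26; 30; 47; 31; 46; 0; 45; 1; 44; 2; 43;
     3; 42; 4; 41; 5; 40; 6; 39; 7; 38; 8; 37; 9; 36; 10; 35; 11; 34; 12; 33; 13; 32; 14; 23];
    [:: 23; 16; 34; 17; 33; 18; 32; 19; 31; 20; 30; 27; 25; 21; 15; 14; 22; 13; 35; 12; 36; 11;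
     37; 10; 38; 9; 39; 8; 40; 7; 41; 6; 42; 5; 43; 4; 44; 3; 45; 2; 46; 1; 47; 0; 49; 28; 48; 29;
     24];
    [:: 24; 31; 21; 32; 20; 33; 19; 34; 18; 35; 17; 36; 13; 37; 12; 38; 11; 39; 10; 40; 9; 41; 8;
     42; 7; 43; 6; 44; 5; 45; 4; 46; 3; 47; 2; 48; 1; 49; 0; 50; 30; 51; 29; 26; 22; 28; 23; 15;
     14; 16; 25];
    [:: 25; 32; 20; 33; 19; 34; 18; 35; 17; 36; 16; 27; 30; 21; 31; 52; 53; 0; 51; 1; 50; 2; 49;
     3; 48; 4; 47; 5; 46; 6; 45; 7; 44; 8; 43; 9; 42; 10; 41; 11; 40; 12; 39; 13; 38; 14; 37; 15;
     23; 29; 24; 22; 26];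
    [:: 26; 33; 23; 34; 22; 35; 21; 36; 20; 37; 19; 38; 18; 39; 17; 15; 14; 40; 13; 41; 12; 42;
     11; 43; 10; 44; 9; 45; 8; 46; 7; 47; 6; 48; 5; 49; 4; 50; 3; 51; 2; 52; 1; 53; 0; 54; 31; 55;
     30; 24; 16; 25; 28; 32; 27];
    [:: 27; 34; 56; 33; 57; 0; 55; 1; 54; 2; 53; 3; 52; 4; 51; 5; 50; 6; 49; 7; 48; 8; 47; 9; 46;
     10; 45; 11; 44; 12; 43; 13; 42; 14; 41; 15; 40; 19; 39; 20; 38; 21; 37; 22; 36; 23; 35; 32;
     31; 25; 17; 26; 16; 18; 29; 24; 28];
    [:: 28; 35; 23; 36; 22; 37; 21; 38; 20; 39; 19; 40; 18; 41; 17; 27; 16; 42; 15; 43; 14; 44;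
     13; 45; 12; 46; 11; 47; 10; 48; 9; 49; 8; 50; 7; 51; 6; 52; 5; 53; 4; 54; 3; 55; 2; 56; 1; 57;
     0; 58; 59; 34; 30; 25; 33; 24; 26; 32; 29];
    [:: 29; 36; 24; 37; 23; 38; 22; 39; 21; 40; 20; 41; 19; 42; 18; 28; 17; 43; 16; 44; 15; 45;
     14; 46; 13; 47; 12; 48; 11; 49; 10; 50; 9; 51; 8; 52; 7; 53; 6; 54; 5; 55; 4; 56; 3; 57; 2;
     58; 1; 59; 0; 61; 60; 35; 31; 26; 34; 25; 27; 33; 30];
    [:: 30; 37; 25; 38; 24; 39; 23; 40; 22; 41; 21; 42; 20; 43; 19; 44; 18; 28; 17; 45; 16; 46;
     15; 47; 14; 48; 13; 49; 12; 50; 11; 51; 10; 52; 9; 53; 8; 54; 7; 55; 6; 56; 5; 57; 4; 58; 3;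
     59; 2; 60; 1; 61; 0; 62; 63; 36; 34; 26; 35; 29; 32; 27; 31];
    [:: 31; 38; 26; 39; 25; 40; 24; 41; 23; 42; 22; 43; 21; 44; 20; 45; 19; 29; 18; 46; 17; 47;
     16; 48; 15; 49; 14; 50; 13; 51; 12; 52; 11; 53; 10; 54; 9; 55; 8; 56; 7; 57; 6; 58; 5; 59; 4;
     60; 3; 61; 2; 62; 1; 63; 0; 65; 64; 37; 35; 27; 36; 30; 33; 28; 32]].

(** An anchored path has 2h + 1 vertices and starts at h + 1 or h - 1, so half its size is [h] and
    the comparison recovers [b]. *)
Definition path_key (s : seq nat) : nat * bool * nat :=
  let h := (size s)./2 in (h, h < head 0 s, nth 0 (abs_diffs s) 0).

(** For [b] true and d = 7 there is no path with h = 5, where 6 has no neighbour at distance 7, or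
    with h = 6, where 0 would need the neighbours 7, 11 and 13. The surgeries for h from 23 to 32
    start at h' = 5 or 6 and switch [b], so for [b] false and d = 7 these h need paths of their own.
    The case h = 3 serves l = 4. *)
Definition seed_key (h : nat) (b : bool) (d : nat) : bool :=
  [|| (5 <= h <= 22) && ~~ [&& b, d == 7 & h <= 6],
      [&& 23 <= h <= 32, ~~ b & d == 7] | [&& h == 3, ~~ b & d == 5]].

Lemma seeds_anchored :
  all (fun s => let: (h, b, d) := path_key s in anchored (~~ odd h) b h d s) seeds.
Proof. by vm_compute. Qed.

Lemma seeds_keys :
  all (fun h => all (fun b => all (fun d => seed_key h b d ==> ((h, b, d) \in map path_key seeds))
    [:: 5; 6; 7]) [:: true; false]) (iota 0 33).
Proof. by vm_compute. Qed.

Lemma seed_exists h b d : d \in [:: 5; 6; 7] -> seed_key h b d ->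
  exists s, anchored (~~ odd h) b h d s.
Proof.
move=> d567 hbd; have h33 : h \in iota 0 33 by rewrite mem_iota; move: hbd; rewrite /seed_key; lia.
have b2 : b \in [:: true; false] by case: b {hbd}.
have /implyP/(_ hbd)/mapP[s s_seed key_s] := allP (allP (allP seeds_keys h h33) b b2) d d567.
by exists s; have := allP seeds_anchored s s_seed; rewrite -key_s.
Qed.

(** * Induction on [h] *)

Lemma anchored_exists h b d :
  d \in [:: 5; 6; 7] -> 5 <= h -> ~~ [&& b, d == 7 & h <= 6] ->
  exists s, anchored (~~ odd h) b h d s.
Proof.
move=> d567; elim/ltn_ind: h b => h IHh b le5h h_ok.
have [|no_seed] := boolP (seed_key h b d); first exact: seed_exists.
have [le23h small_ok] : 23 <= h /\ (33 <= h \/ ~~ [&& ~~ b & d == 7]).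
  by move: no_seed; rewrite /seed_key; case: b h_ok => /=; lia.
(* The predecessor is of kind [~~ b]. It could be an excluded one only for [b] false and d = 7; then
   33 <= h, and its half-length is at least 7. *)
have IH k : k + 2 < h -> 5 <= k + 2 -> (33 <= h -> 7 <= k + 2) ->
    exists s, anchored (~~ odd (k + 2)) (~~ b) (k + 2) d s.
  by move=> *; apply: IHh => //; case: b small_ok {no_seed h_ok} => /=; lia.
rewrite -[b]negbK.
(* Remainders 0 to 2, 3 to 6 and 7 to 9 use h' = 2q + 2, 2q + 3 and 2q + 4 respectively. *)
have [q [r [ltr10 hE]]] : exists q r, r < 10 /\ h = 10 * q.+1 + r.
  by exists (h %/ 10).-1, (h %% 10); lia.
have even_pred k : ~~ odd k -> k + 2 < h -> 5 <= k + 2 -> (33 <= h -> 7 <= k + 2) ->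
    exists s, anchored true (~~ b) (k + 2) d s.
  by move=> ev_k *; have -> : true = ~~ odd (k + 2) by [lia]; apply: IH.
have odd_pred k : odd k -> k + 2 < h -> 5 <= k + 2 -> (33 <= h -> 7 <= k + 2) ->
    exists s, anchored false (~~ b) (k + 2) d s.
  by move=> od_k *; have -> : false = ~~ odd (k + 2) by [lia]; apply: IH.
(* One goal for each remainder; the last goal, with a remainder of at least 10, is contradictory. *)
do 10?[case: r => [|r] in ltr10 hE *].
- have [-> ->] : h = 5 * (2 * q) + 10 /\ ~~ odd h = true by lia.
  by apply: even_to_even_5h; [lia | apply: even_pred; lia].
- have [-> ->] : h = 5 * (2 * q) + 11 /\ ~~ odd h = false by lia.
  by apply: even_to_odd_5h_plus1; [lia | apply: even_pred; lia].
- have [-> ->] : h = 5 * (2 * q) + 12 /\ ~~ odd h = true by lia.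
  by apply: even_to_even_5h_plus2; [lia | apply: even_pred; lia].
- have [-> ->] : h = 5 * (2 * q + 1) + 8 /\ ~~ odd h = false by lia.
  by apply: odd_to_odd_5h_minus2; [lia | apply: odd_pred; lia].
- have [-> ->] : h = 5 * (2 * q + 1) + 9 /\ ~~ odd h = true by lia.
  by apply: odd_to_even_5h_minus1; [lia | apply: odd_pred; lia].
- have [-> ->] : h = 5 * (2 * q + 1) + 10 /\ ~~ odd h = false by lia.
  by apply: odd_to_odd_5h; [lia | apply: odd_pred; lia].
- have [-> ->] : h = 5 * (2 * q + 1) + 11 /\ ~~ odd h = true by lia.
  by apply: odd_to_even_5h_plus1; [lia | apply: odd_pred; lia].
- have [-> ->] : h = 5 * (2 * q + 2) + 7 /\ ~~ odd h = false by lia.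
  by apply: even_to_odd_5h_minus3; [lia | apply: even_pred; lia].
- have [-> ->] : h = 5 * (2 * q + 2) + 8 /\ ~~ odd h = true by lia.
  by apply: even_to_even_5h_minus2; [lia | apply: even_pred; lia].
- have [-> ->] : h = 5 * (2 * q + 2) + 9 /\ ~~ odd h = false by lia.
  by apply: even_to_odd_5h_minus1; [lia | apply: even_pred; lia].
- by lia.
Qed.

(** * Return to cracked graceful permutations *)

(* The reflection [z |-> h.*2.+1 - z] turns the crack [h + 2] of an anchored path into
   [l - 2] for [l = h + 1]. *)
Lemma anchored_cracked h d s : 3 <= h -> anchored false false h d s ->
  let l := h.+1 in let s2 := [seq h.*2.+1 - z | z <- s] in
  [/\ cracked_graceful (2 * l - 1) s2, is_crack (2 * l - 1) s2 (l - 2),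
      head 0 s2 = l + 1, last 0 s2 = l & nth 0 (abs_diffs s2) 0 = d].
Proof.
move=> le3h /andP[path_s _]; set S := h.*2.+1.
have lew : h + 2 <= S by rewrite /S; lia.
have [uniq_s mem_s] := punctured_path_perm lew path_s.
have les z : z \in s -> z <= S by rewrite mem_s mem_filter mem_iota /S; lia.
case/and5P: path_s => /eqP size_s _ /allP diff_s /eqP head_s /andP[/eqP last_s /eqP fst_s].
have ds2 : abs_diffs [seq S - z | z <- s] = abs_diffs s by apply/abs_diffs_subl/allP.
have SE : 2 * h.+1 - 1 = S by rewrite /S; lia.
rewrite /= ds2 SE; split=> //.
- apply/and4P; split.
  + by rewrite size_map size_s.
  + by rewrite map_inj_in_uniq // => z1 z2 /les le1 /les le2; lia.
  + by apply/allP => _ /mapP[z _ ->]; lia.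
  (* For the odd kind [g] is [S], so the S - 1 differences cover 1, ..., S - 1 and are a permutation
     of them. *)
  + rewrite ds2 perm_sym; have uniqI := iota_uniq 1 S.-1.
    have subI : {subset iota 1 S.-1 <= abs_diffs s}.
      by move=> e; rewrite mem_iota => eS; apply: diff_s; rewrite mem_filter mem_iota; lia.
    have leI : size (abs_diffs s) <= size (iota 1 S.-1).
      by rewrite size_abs_diffs size_iota size_s.
    have [eq_size eqI] := uniq_min_size uniqI subI leI.
    by apply: uniq_perm => //; rewrite -(eq_uniq eq_size eqI).
- rewrite /is_crack; apply/andP; split; first by rewrite /S; lia.
  (* A vertex reflected to l - 2 would be the omitted h + 2. *)
  apply/negP => /mapP[z zs zE]; have := zs.
  by rewrite mem_s mem_filter mem_iota; move: (les z zs) zE; rewrite /S; lia.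
- case: s size_s head_s {uniq_s mem_s les diff_s last_s fst_s ds2} => //= x s _ ->.
  by rewrite /S; lia.
- case: s size_s last_s {uniq_s mem_s les diff_s head_s fst_s ds2} => //= x s _ last_s.
  by rewrite (last_map (fun z => S - z)) last_s /S; lia.
Qed.

Theorem theorem5p12 (d l : nat) :
  d \in [:: 5; 6; 7] -> ~~ odd l -> 2 < l ->
  ~ (l = 4 /\ d \in [:: 6; 7]) ->
  exists s : seq nat,
    [/\ cracked_graceful (2 * l - 1) s,
        is_crack (2 * l - 1) s (l - 2),
        head 0 s = l + 1,
        last 0 s = l &
        nth 0 (abs_diffs s) 0 = d].
Proof.
move=> d567 even_l lt2l not_l4.
have [s path_s] : exists s, anchored false false l.-1 d s.
  have -> : false = ~~ odd l.-1 by lia.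
  have [le6l|lt_l6] := leqP 6 l; first by apply: anchored_exists => //; lia.
  (* Only l = 4 remains; the excluded pairs leave d = 5, which is the seed with h = 3. *)
  have l4 : l = 4 by lia.
  have d5 : d = 5.
    move: d567; rewrite !inE => /or3P[] /eqP // dE; case: not_l4.
      by rewrite dE.
    by rewrite dE.
  by apply: seed_exists => //; rewrite l4 d5.
have := anchored_cracked (ltac:(lia) : 3 <= l.-1) path_s.
by rewrite /= prednK ?(ltnW (ltnW lt2l)) //; eexists; eassumption.
Qed.
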